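(* Let $G$ be a finite complete group of even order. Then $G$ is not a GCI-group.
   Context: A group $G$ is complete if $Z(G)=\{e\}$ and $\mathrm{Aut}(G)=\mathrm{Inn}(G)$. For $y\in G$ and $\alpha\in\mathrm{Aut}(G)$, $y^\alpha$ denotes the image of $y$ under $\alpha$; for $S\subseteq G$, $S^\alpha=\{s^\alpha\mid s\in S\}$. Products of automorphisms act by $y^{\beta\alpha}=(y^\alpha)^\beta$. Generalized Cayley graphs: given a finite group $G$, an automorphism $\alpha\in\mathrm{Aut}(G)$ and $S\subseteq G$, suppose (a) $\alpha^2=\mathrm{id}$; (b) for every $y\in G$, $(y^{-1})^\alpha y\notin S$; (c) for all $y,h\in G$, if $(h^{-1})^\alpha y\in S$ then $(y^{-1})^\alpha h\in S$. Then $S$ is called a generalized Cayley subset of $G$ induced by $\alpha$, and $GC(G,S,\alpha)$ is the graph with vertex set $G$ and edge set $\{\{y,h\}\mid (y^{-1})^\alpha h\in S\}$. (The case $\alpha=\mathrm{id}$ is allowed and gives the Cayley graphs.) A finite group $G$ is a GCI-group if for any two generalized Cayley graphs $X_i=GC(G,S_i,\alpha_i)$ $(i=1,2)$ of $G$ (each $\alpha_i$ being the identity or an involution in $\mathrm{Aut}(G)$), $X_1\cong X_2$ implies that there exist $y\in G$ and $\gamma\in\mathrm{Aut}(G)$ such that $\alpha_2=\gamma\alpha_1\gamma^{-1}$ and $S_2=y^{\alpha_2}S_1^\gamma y^{-1}$. *)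

(* Defs.v *)
From mathcomp Require Import all_boot all_fingroup center.

Set Implicit Arguments.
Unset Strict Implicit.
Unset Printing Implicit Defensive.

Local Open Scope group_scope.

Record graph (T : finType) := Graph {
  vertices : {set T};
  edges : {set {set T}}
}.

Definition isomorphic (T : finType) (X1 X2 : graph T) : Prop :=
  exists f : T -> T,
    [/\ {in vertices X1 &, injective f},
        f @: vertices X1 = vertices X2 &
        {in vertices X1 &, forall x y,
           ([set x; y] \in edges X1) = ([set f x; f y] \in edges X2)}].

Section GeneralizedCayley.

Variables (gT : finGroupType) (G : {group gT}).

Definition Inn : {set {perm gT}} := conj_aut G @* G.

Definition complete_group : Prop := 'Z(G) = 1 /\ Aut G = Inn.

Implicit Types (a : {perm gT}) (S : {set gT}).

(* The exponent notation z^a for automorphisms is the application [a z] below; MathComp's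
   [_ ^ _] would be conjugation. *)
Definition gen_cayley_subset a S : Prop :=
  [/\ S \subset G,
      a * a = 1,
      forall y, y \in G -> a y^-1 * y \notin S &
      forall y h, y \in G -> h \in G -> a h^-1 * y \in S -> a y^-1 * h \in S].

Definition GC S a : graph gT :=
  Graph G [set [set y; h] | y in G, h in G & a y^-1 * h \in S].

(* The group law of [{perm gT}] composes left to right, [(s * t) x = t (s x)],
   so the automorphism written g a1 g^-1 in right-to-left notation is
   [g^-1 * a1 * g]. *)
Definition GCI_group : Prop :=
  forall a1 a2 S1 S2,
    a1 \in Aut G -> a2 \in Aut G ->
    gen_cayley_subset a1 S1 -> gen_cayley_subset a2 S2 ->
    isomorphic (GC S1 a1) (GC S2 a2) ->
  exists y g,
    [/\ y \in G, g \in Aut G, a2 = g^-1 * a1 * g &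
        S2 = a2 y *: (g @: S1) :* y^-1].

End GeneralizedCayley.

(* Main.v *)
Require Import Defs.
From mathcomp Require Import all_boot all_fingroup.
From mathcomp Require Import center pgroup.

(** For an involution [t] of [G], inversion maps the perfect matching
    [{y, y t}], a Cayley graph, onto the perfect matching [{y, t y}], which is
    the generalized Cayley graph of [{t}] induced by conjugation by [t]. As
    [Z(G) = 1], this conjugation is not the identity, so it is not conjugate
    to the automorphism inducing the first graph. *)

Set Implicit Arguments.
Unset Strict Implicit.
Unset Printing Implicit Defensive.

Local Open Scope group_scope.

(** An edge is an unordered pair, so its witness may be [(x, y)] or [(y, x)]; the symmetry condition
    on [S] makes both orders give the same test. *)
Lemma mem_edges_GC (gT : finGroupType) (G : {group gT}) a (S : {set gT}) x y :
    gen_cayley_subset G a S -> x \in G -> y \in G ->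
  ([set x; y] \in edges (GC G S a)) = (a x^-1 * y \in S).
Proof.
case=> _ _ _ symS Gx Gy; apply/imset2P/idP => [[u v Gu]|Sxy]; last first.
  by exists x y => //; rewrite inE Gy.
rewrite inE => /andP[Gv Suv] eq_xy.
have: x \in [set u; v] by rewrite -eq_xy set21.
have: y \in [set u; v] by rewrite -eq_xy set22.
have: u \in [set x; y] by rewrite eq_xy set21.
have: v \in [set x; y] by rewrite eq_xy set22.
rewrite !inE => /pred2P[] Ev /pred2P[] Eu; subst => /pred2P[] E1 /pred2P[] E2;
  by subst => //; apply: symS.
Qed.

Section Involution.

Variables (gT : finGroupType) (G : {group gT}) (t : gT).
Hypotheses (Gt : t \in G) (ot : #[t] = 2).

Let tt : t * t = 1.
Proof. by have := expg_order t; rewrite ot expgS expg1. Qed.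

Let tV : t^-1 = t.
Proof. by apply/eqP; rewrite eq_invg_mul tt. Qed.

Let t_neq1 : t != 1.
Proof. by rewrite -order_eq1 ot. Qed.

Lemma gen_cayley_involution_id : gen_cayley_subset G 1 [set t].
Proof.
split; rewrite ?sub1set ?mulg1 // => y.
  by rewrite perm1 mulVg inE eq_sym.
move=> h _ _; rewrite !perm1 !inE => /eqP Et.
by rewrite -[y^-1 * h]invgK invMg invgK Et tV.
Qed.

(** Solving for [y] gives [y = x ^ t * t = t * x * t * t], and [t * t = 1] cancels the tail. Hence
    the neighbour of [x] is its left translate by [t]. *)
Lemma conj_aut_involutionE x y :
  x \in G -> (conj_aut G t x^-1 * y == t) = (y == t * x).
Proof.
move=> Gx; rewrite norm_conj_autE ?groupV ?(subsetP (normG G)) //.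
rewrite conjVg -(inj_eq (mulgI (x ^ t))) mulKVg conjgE tV.
by rewrite -!mulgA tt mulg1.
Qed.

Lemma gen_cayley_involution_conj :
  gen_cayley_subset G (conj_aut G t) [set t].
Proof.
have Nt := subsetP (normG G) t Gt.
split; rewrite ?sub1set //.
- by rewrite -morphM // tt morph1.
- move=> y Gy; rewrite inE conj_aut_involutionE //.
  by rewrite eq_sym -{2}[y]mul1g (inj_eq (mulIg _)).
move=> y h Gy Gh; rewrite !inE !conj_aut_involutionE // => /eqP->.
by rewrite mulgA tt mul1g.
Qed.

Lemma isomorphic_GC_involution :
  isomorphic (GC G [set t] 1) (GC G [set t] (conj_aut G t)).
Proof.
exists (fun x => x^-1); split=> [x y _ _||x y Gx Gy]; first exact: invg_inj.
  apply/setP=> x; rewrite -{1}[x]invgK mem_imset /= ?groupV //.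
  exact: invg_inj.
rewrite (mem_edges_GC gen_cayley_involution_id) //.
rewrite (mem_edges_GC gen_cayley_involution_conj) ?groupV //.
rewrite perm1 !inE conj_aut_involutionE ?groupV //.
(* The left side says [y = x * t]; inverting it gives [y^-1 = t * x^-1]. *)
by rewrite -(inj_eq (mulgI x)) mulKVg -(inj_eq invg_inj) invMg tV.
Qed.

End Involution.

Theorem theorem4p7 (gT : finGroupType) (G : {group gT}) :
  complete_group G -> ~~ odd #|G| -> ~ GCI_group G.
Proof.
case=> Z1 _; rewrite -dvdn2 => /(Cauchy (isT : prime 2))[t Gt ot] GCI.
have [||_ [g [_ _ a2E _]]] := GCI _ _ _ _ _ _ (gen_cayley_involution_id Gt ot)
  (gen_cayley_involution_conj Gt ot) (isomorphic_GC_involution Gt ot).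
- exact: group1.
- exact: Aut_aut.
(* The first graph is induced by the identity, so [a2E] makes conjugation by [t] equal to
   [g^-1 * 1 * g = 1]. The kernel of [conj_aut G] consists of the elements centralizing [G]. *)
have: t \in 'ker (conj_aut G).
  by apply/(kerP _ (subsetP (normG G) t Gt)); rewrite /= a2E mulg1 mulVg.
rewrite ker_conj_aut => Ct.
have: t \in 'Z(G) by rewrite inE Gt.
by rewrite Z1 inE -order_eq1 ot.
Qed.
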